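(* Let $n\ge 1$ be an integer, let $(G,S_1,S_2)$ be an $(n\times n)$-slab whose rows and columns have maximum degree at most $\Delta$, where $\Delta\ge 3$, and let $X$ be a subset of $V(G)\setminus (V(S_1)\cup V(S_2))$. If every path in $G$ from $S_1$ to $S_2$ intersects $X$, then $G[X]$ has tree-width at least $\frac{n}{\sqrt{3\Delta}}-1$.
   Context: Graphs are finite and simple. A plane graph $H$ is a near-triangulation if every face of $H$ except for the outer one has length three. A triple $(G,S_1,S_2)$, where $G$ is a graph and $S_1$ and $S_2$ are vertex-disjoint connected subgraphs of $G$, is an $(n\times n)$-slab (with sides $S_1$ and $S_2$) if there exist pairwise vertex-disjoint near-triangulations $R_1,\ldots,R_n\subseteq G$ (the rows of the slab; each is a subgraph of $G$ equipped with a plane embedding) and pairwise vertex-disjoint near-triangulations $C_1,\ldots,C_n\subseteq G$ (the columns of the slab) such that: (1) for $1\le i,j\le n$, the intersection $R_i\cap C_j$ is a path with one end in $S_1$ and the other end in $S_2$; and (2) for $s\in\{1,2\}$ and for every row or column $H$, the intersection of $H$ with $S_s$ is a subpath of the boundary of the outer face of $H$. The hypothesis on $\Delta$ means that the rows and columns can be chosen so that each of the graphs $R_1,\ldots,R_n,C_1,\ldots,C_n$ has maximum degree at most $\Delta$. Tree-width is the minimum width of a tree decomposition, where width is the maximum bag size minus one. *)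

(* Defs.v *)
From mathcomp Require Import all_boot all_order all_fingroup all_algebra.
From mathcomp Require Import boolp reals.
Set Implicit Arguments.
Unset Strict Implicit.
Unset Printing Implicit Defensive.

#[local] Obligation Tactic := idtac.

(** * Finite simple graphs

    All graphs of interest live on vertices drawn from a common finite type
    [T], so that a graph and its subgraphs have the same type. *)

Record graph (T : finType) := Graph {
  vset : {set T};
  adj : rel T;
  adj_sym : symmetric adj;
  adj_irr : irreflexive adj;
  adj_vset : forall x y, adj x y -> x \in vset
}.

Section Graphs.
Variable T : finType.
Implicit Types (G H : graph T) (A X : {set T}).

Definition edges H : {set {set T}} :=
  [set [set d.1; d.2] | d : T * T & adj H d.1 d.2].

Definition subgraph H G :=
  vset H \subset vset G /\ (forall x y, adj H x y -> adj G x y).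

Program Definition gcap G H : graph T :=
  {| vset := vset G :&: vset H; adj := fun x y => adj G x y && adj H x y |}.
Next Obligation. by move=> G H x y; rewrite !(adj_sym _ x). Qed.
Next Obligation. by move=> G H x; rewrite adj_irr. Qed.
Next Obligation.
by move=> G H x y /andP[/adj_vset Gx /adj_vset Hx]; rewrite inE Gx.
Qed.

Program Definition induced G A : graph T :=
  {| vset := vset G :&: A;
     adj := fun x y => [&& adj G x y, x \in A & y \in A] |}.
Next Obligation. by move=> G A x y; rewrite adj_sym [(y \in A) && _]andbC. Qed.
Next Obligation. by move=> G A x; rewrite adj_irr. Qed.
Next Obligation.
by move=> G A x y /and3P[/adj_vset Gx Ax _]; rewrite inE Gx.
Qed.

Definition connected H :=
  vset H != set0 /\ {in vset H &, forall x y, connect (adj H) x y}.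

Definition acyclic H := forall c : seq T, ucycle (adj H) c -> size c < 3.

Definition tree H := connected H /\ acyclic H.

(* [H] is the path whose vertices are, in order, [x :: p]. *)
Definition is_path H (x : T) (p : seq T) :=
  [/\ uniq (x :: p), vset H = [set:: x :: p] &
      forall a b, adj H a b =
        ((a, b) \in zip (x :: p) p) || ((b, a) \in zip (x :: p) p)].

Definition max_degree_le H (D : nat) :=
  {in vset H, forall x, #|[set y | adj H x y]| <= D}.

End Graphs.

(** * Tree-width *)

Definition tree_decomposition (T N : finType) (H : graph T)
    (t : graph N) (bag : N -> {set T}) :=
  [/\ tree t,
      {in vset t, forall i, bag i \subset vset H},
      (forall x y, adj H x y ->
         exists2 i, i \in vset t & (x \in bag i) && (y \in bag i)) &
      (* nodes whose bag contains [x]: a nonempty subtree *)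
      {in vset H, forall x, connected (induced t [set i | x \in bag i])}].

Definition has_max_bag (T : finType) (H : graph T) (k : nat) :=
  exists (N : finType) (t : graph N) (bag : N -> {set T}),
    tree_decomposition H t bag /\ \max_(i in vset t) #|bag i| = k.

Lemma has_max_bag_ex (T : finType) (H : graph T) :
  exists k, `[< has_max_bag H k >].
Proof.
pose t : graph unit := @Graph _ [set: unit] (fun _ _ => false)
  (fun _ _ => erefl) (fun _ => erefl) (fun _ _ h => ltac:(by [])).
exists (\max_(i in vset t) #|(fun=> vset H) i|); apply/asboolP.
exists unit, t, (fun=> vset H); split=> //; split=> //.
- split; first split; first by apply/set0Pn; exists tt; rewrite inE.
  + by case=> -[].
  + by case=> [|x [|y c]] //= /andP[].
- move=> x y xy; exists tt; first by rewrite inE.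
  by rewrite (adj_vset xy); move: xy; rewrite adj_sym => /adj_vset->.
- move=> x xH; split; first by apply/set0Pn; exists tt; rewrite !inE.
  by case=> -[].
Qed.

(* The minimum width of a tree decomposition; it is an integer because the
   graph without vertices has tree-width -1. *)
Definition treewidth (T : finType) (H : graph T) : int :=
  ((ex_minn (has_max_bag_ex H))%:Z - 1)%R.

(** * Plane graphs

    A plane embedding is given combinatorially.  [rot x] sends each neighbour
    of [x] to the next one in the cyclic order around [x].  A dart is a pair
    [(x, y)] of adjacent vertices, i.e. a directed edge; [side x y] is the face
    on a fixed side of it, and the dart that follows [(x, y)] along that face
    is [(y, rot y x)].  Since the graph may be disconnected, a face may have
    several boundary walks, and the face containing an isolated vertex [x] is
    given by [around x].

    The embedding is in the plane when Euler's formula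
    V - E + F = 1 + (number of components) holds.  For disconnected graphs the
    formula is supplemented by [face_linked]: passing from a face to another
    one with a common incident vertex, one reaches every face from every other.
    Indeed let B be the number of boundary walks (counting one trivial walk for
    each isolated vertex) and C the number of components.  [face_linked] makes
    the bipartite incidence multigraph between components and faces, which has
    B edges, connected, so B >= C + F - 1; and V - E + B <= 2C for any rotation
    system, with equality iff every component has genus 0.  Euler's formula
    forces equality in both, i.e. every component is embedded in the sphere and
    the incidence multigraph is a tree.  The face [outer] is then the one
    containing the point at infinity. *)

Section FaceIncidence.
Variables (T F : finType) (H : graph T).
Variables (side : T -> T -> F) (around : T -> F).

Definition incident (x : T) (f : F) : bool :=
  (x \in vset H) &&
  if [exists y, adj H x y] then [exists y, adj H x y && (side x y == f)]
  else around x == f.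

End FaceIncidence.

Record plane_graph (T : finType) := PlaneGraph {
  pgraph :> graph T;
  rot : T -> {perm T};
  face : finType;
  side : T -> T -> face;
  around : T -> face;
  outer : face;
  rot_cyclic : forall x y, adj pgraph x y ->
    porbit (rot x) y = [set z | adj pgraph x z];
  side_next : forall x y, adj pgraph x y -> side y (rot y x) = side x y;
  face_linked : forall f g : face,
    connect (fun f g => [exists x, incident pgraph side around x f
                                && incident pgraph side around x g]) f g;
  euler : #|vset pgraph| + #|face|
          = #|edges pgraph| + n_comp (adj pgraph) (vset pgraph) + 1
}.

Section PlaneGraphs.
Variables (T : finType) (H : plane_graph T).

(* An edge with the face on both of its sides is counted twice. *)
Definition face_length (f : face H) : nat :=
  #|[set d : T * T | adj H d.1 d.2 && (side H d.1 d.2 == f)]|.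

Program Definition face_boundary (f : face H) : graph T :=
  {| vset := [set x | incident H (@side _ H) (@around _ H) x f];
     adj := fun x y => adj H x y && ((side H x y == f) || (side H y x == f)) |}.
Next Obligation. by move=> f x y; rewrite adj_sym orbC. Qed.
Next Obligation. by move=> f x; rewrite adj_irr. Qed.
Next Obligation.
move=> f x y /andP[xy sxy]; rewrite inE /incident (adj_vset xy) /=.
rewrite ifT; last by apply/existsP; exists y.
apply/existsP; case/orP: sxy => [sxy|syx]; first by exists y; rewrite xy.
have yx : adj H y x by rewrite adj_sym.
exists (rot H x y); rewrite (side_next yx) syx andbT.
by have := mem_porbit (rot H x) 1 y; rewrite (rot_cyclic xy) inE expg1.
Qed.

Definition near_triangulation :=
  forall f : face H, f != outer H -> face_length f = 3.

End PlaneGraphs.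

(** * Slabs *)

(* [(G, S1, S2)] is an (n x n)-slab, with the given rows and columns. *)
Definition slab (T : finType) (n : nat) (G S1 S2 : graph T)
    (rows cols : 'I_n -> plane_graph T) :=
  let line (H : plane_graph T) :=
    [/\ subgraph H G, near_triangulation H &
        forall S, S = S1 \/ S = S2 ->
          (exists x p, is_path (gcap H S) x p) /\
          subgraph (gcap H S) (face_boundary (outer H))] in
  [/\ [/\ subgraph S1 G, subgraph S2 G, connected S1, connected S2 &
          [disjoint vset S1 & vset S2]],
      (forall i, line (rows i)) /\ (forall j, line (cols j)),
      (forall i j, i != j -> [disjoint vset (rows i) & vset (rows j)]),
      (forall i j, i != j -> [disjoint vset (cols i) & vset (cols j)]) &
      forall i j, exists x p,
        [/\ is_path (gcap (rows i) (cols j)) x p,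
            x \in vset S1 & last x p \in vset S2]].

(* Every path of [G] from [S1] to [S2] intersects [X]. *)
Definition separates (T : finType) (G S1 S2 : graph T) (X : {set T}) :=
  forall (x : T) (p : seq T), path (adj G) x p -> uniq (x :: p) ->
    x \in vset S1 -> last x p \in vset S2 -> has (mem X) (x :: p).

(* Main.v *)
(* The bound obtained is in fact [n - 1 <= treewidth].

   Let A be the set of vertices reachable from S1 in G - X.  For W included in
   X, count modulo 2 the edges between W and A along the path of a row and a
   column.  If W has no edges to the rest of X inside a row, then no inner
   triangle of the row has an odd number of W-A edges; since a near-triangulation
   has no cohomology in degree 1, this cocycle is a coboundary, so that the count
   depends only on the row.  The same holds for columns.  For W = X the count is
   1, as A contains S1, avoids S2 and has no neighbours outside A and X.

   If all bags had fewer than n vertices, each bag B would miss some row and some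
   column, and the counts for these would be well defined on the parts of X - B
   lying beyond each tree edge at B.  They add up to 1, so some part is odd;
   moving to the corresponding neighbour and repeating, one never turns back,
   which is impossible in a finite tree. *)

Require Import Defs.
From mathcomp Require Import all_boot all_order all_fingroup all_algebra.
From mathcomp Require Import reals boolp.
From mathcomp Require Import zify.
Set Implicit Arguments.
Unset Strict Implicit.
Unset Printing Implicit Defensive.
Import Order.TTheory GRing.Theory Num.Theory.

(** * Cohomology of near-triangulations *)

Section RowExtension.
Variables (I : finType) (A : {set I}).
Implicit Type u : 'rV[bool]_#|A|.

Lemma sum_enum_val (F : I -> bool) :
  (\sum_(i < #|A|) F (enum_val i) = \sum_(x in A) F x)%R.
Proof. exact: (esym (big_enum_val (A := fun x => x \in A) F)). Qed.

(** [bool] serves as the two-element field, with [addb] as addition. At most one index contributes,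
    so this extends [u] by zero to all of [I] and lets row vectors be handled as functions. *)
Definition row_ext u (x : I) : bool := (\sum_(i | enum_val i == x) u 0 i)%R.

Lemma row_ext_enum u i : row_ext u (enum_val i) = u 0%R i.
Proof.
by rewrite /row_ext (big_pred1 i) // => j; rewrite /= (inj_eq enum_val_inj).
Qed.

Lemma row_ext_out u x : x \notin A -> row_ext u x = false.
Proof.
move=> Ax; rewrite /row_ext big_pred0 // => i.
by apply: contraNF Ax => /eqP <-; apply: enum_valP.
Qed.

Lemma row_ext_sum u (F : I -> bool) :
  (\sum_i u 0 i * F (enum_val i) = \sum_(x in A) row_ext u x * F x)%R.
Proof.
rewrite -(sum_enum_val (fun x => row_ext u x * F x)%R).
by apply: eq_bigr => i _; rewrite row_ext_enum.
Qed.

End RowExtension.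

(** * Boundary matrices modulo 2 and the rank count *)

Section Cohomology.
Variables (T : finType) (H : plane_graph T).

Definition darts (f : face H) : {set T * T} :=
  [set d | adj H d.1 d.2 && (side H d.1 d.2 == f)].

Lemma rot_adj x y : adj H x y -> adj H x (Defs.rot H x y).
Proof.
move=> xy; have := mem_porbit (Defs.rot H x) 1 y.
by rewrite (rot_cyclic xy) inE expg1.
Qed.

(** Passing to the next dart of the face permutes its three darts and fixes none of them, the graph
    having no loops; such a permutation of three points is a 3-cycle. *)
Lemma darts_triangle f : #|darts f| = 3 ->
  exists x y z, [/\ adj H x y, adj H y z, adj H z x &
                    darts f = [set (x, y); (y, z); (z, x)]].
Proof.
pose nx (d : T * T) := (d.2, Defs.rot H d.2 d.1).
have nx_in d : d \in darts f -> nx d \in darts f.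
  case: d => x y; rewrite !inE /= => /andP[xy /eqP <-].
  by rewrite side_next // eqxx andbT rot_adj // adj_sym.
have nx_neq d : d \in darts f -> nx d != d.
  case: d => x y; rewrite !inE /= => /andP[xy _].
  by apply: contraTneq xy => -[-> _]; rewrite adj_irr.
have nx_inj : injective nx.
  by move=> [x y] [x' y'] [/= -> /perm_inj ->].
move=> c3; have /card_gt0P[d0 d0f] : 0 < #|darts f| by rewrite c3.
have d1f := nx_in _ d0f; have d2f := nx_in _ d1f; have d3f := nx_in _ d2f.
have n01 := nx_neq _ d0f; have n12 := nx_neq _ d1f; have n23 := nx_neq _ d2f.
have c1 d d' : d \in darts f -> d' \in darts f -> d' != d ->
    #|darts f :\ d :\ d'| = 1.
  move=> df d'f nd; have := cardsD1 d (darts f); rewrite df c3 add1n => -[e].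
  have := cardsD1 d' (darts f :\ d).
  by rewrite in_setD1 nd d'f -e add1n => -[<-].
(* If [nx] swapped two darts, injectivity would force it to fix the third. *)
have n02 : nx (nx d0) != d0.
  apply/eqP=> e02; have /eqP/cards1P[d Dd] := c1 _ _ d0f d1f n01.
  have : d \in darts f :\ d0 :\ nx d0 by rewrite Dd set11.
  rewrite 2!in_setD1 => /and3P[dd1 dd0 df].
  have : nx d \notin darts f :\ d0 :\ nx d0 by rewrite Dd in_set1 nx_neq.
  rewrite 2!in_setD1 nx_in // andbT (inj_eq nx_inj) dd0 /= negbK => /eqP e.
  by case/eqP: dd1; apply: nx_inj; rewrite e.
have Ddarts : darts f = [set d0; nx d0; nx (nx d0)].
  apply/esym/eqP; rewrite eqEcard c3 -setUA !subUset !sub1set d0f d1f d2f /=.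
  by rewrite cardsU1 cards2 !inE negb_or ![d0 == _]eq_sym n01 n02 eq_sym n12.
have : nx (nx (nx d0)) \in darts f by [].
rewrite Ddarts !inE (negPf n23) orbF (inj_eq nx_inj) (negPf n02) orbF => /eqP.
have d_adj d : d \in darts f -> adj H d.1 d.2 by rewrite inE => /andP[].
move=> {n01 n12 n23 n02 d3f nx_in nx_neq nx_inj c1}.
move: (d_adj _ d0f) (d_adj _ d1f) (d_adj _ d2f) Ddarts => {d_adj d0f d1f d2f}.
case: d0 => x y; rewrite /nx /=; move: (Defs.rot H y x) => z xy yz zx D [ez ex].
exists x, y, z; rewrite ez in zx D; split; rewrite ?ez //.
Qed.

Definition dedge (d : T * T) : {set T} := [set d.1; d.2].

Lemma dedge_inj_or x y x' y' : dedge (x, y) = dedge (x', y') ->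
  (x, y) = (x', y') \/ (x, y) = (y', x').
Proof.
rewrite /dedge /= => e.
have : x \in [set x'; y'] by rewrite -e set21.
have : y \in [set x'; y'] by rewrite -e set22.
have : x' \in [set x; y] by rewrite e set21.
have : y' \in [set x; y] by rewrite e set22.
by rewrite !inE; do 4![case/orP=> /eqP ?]; subst; auto.
Qed.

Lemma dedge_edges d : adj H d.1 d.2 -> dedge d \in edges H.
Proof. by move=> dH; apply/imsetP; exists d; rewrite ?inE. Qed.

Lemma sum_dedge (w : T * T -> bool) x y : adj H x y ->
  (\sum_(d | adj H d.1 d.2 && (dedge d == dedge (x, y))) w d
   = w (x, y) + w (y, x))%R.
Proof.
move=> xy; have yx : adj H y x by rewrite adj_sym.
have nd : (y, x) != (x, y).
  by apply: contraTneq xy => -[-> _]; rewrite adj_irr.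
rewrite (bigD1 (x, y)) /= ?xy ?eqxx // (bigD1 (y, x)) /=; last first.
  by rewrite yx nd andbT /dedge setUC /= eqxx.
rewrite big_pred0 ?addr0 // => -[a b] /=; apply/negP => /andP[/andP[/andP[_ /eqP]]].
by case/dedge_inj_or=> ->; rewrite eqxx.
Qed.

(** The face boundary map modulo 2: an edge with the same face on both sides has entry 0. The outer
    face gets no column, which makes the columns independent. *)
Definition edge_face : 'M[bool]_(#|edges H|, #|[set~ outer H]|) :=
  (\matrix_(e, f) \sum_(d in darts (enum_val f) | dedge d == enum_val e) 1)%R.

(** [u *m vertex_edge] is the coboundary of the vertex function [u]. *)
Definition vertex_edge : 'M[bool]_(#|vset H|, #|edges H|) :=
  (\matrix_(i, e) ((enum_val i : T) \in (enum_val e : {set T})))%R.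

Lemma edge_face_row (psi : {set T} -> bool) (u : 'rV_#|edges H|) f :
  (forall e, u 0%R e = psi (enum_val e)) ->
  ((u *m edge_face) 0 f = \sum_(d in darts (enum_val f)) psi (dedge d))%R.
Proof.
move=> uE; rewrite mxE.
pose F e := (\sum_(d in darts (enum_val f) | dedge d == e) psi (dedge d))%R.
rewrite (eq_bigr (fun e => F (enum_val e))); last first.
  move=> e _; rewrite uE mxE mulr_sumr; apply: eq_bigr => d /andP[_ /eqP ->].
  exact: mulr1.
rewrite (sum_enum_val _ F) /F; apply/esym/partition_big => d.
by rewrite inE => /andP[/dedge_edges].
Qed.

(** A dependency between the columns is a function [w] on faces, zero at [outer], that agrees on the
    two sides of each edge. Turning around a vertex, it agrees on all faces incident there, and
    [face_linked] carries the zero to every face. *)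
Lemma edge_face_rank : \rank edge_face = #|face H|.-1.
Proof.
have -> : #|face H|.-1 = #|[set~ outer H]| by rewrite cardsC1.
rewrite -mxrank_tr; apply/eqP.
rewrite -[_ == _]/(row_free _) -kermx_eq0; apply/rowV0P => u /sub_kermxP uM.
pose w := row_ext u.
have w_side x y : adj H x y -> w (side H x y) = w (side H y x).
  move=> xy; have eE := dedge_edges (d := (x, y)) xy.
  have := congr1 (fun M : 'rV_ _ => M 0%R (enum_rank_in eE (dedge (x, y)))) uM.
  rewrite !mxE.
  under eq_bigr do rewrite !mxE enum_rankK_in //.
  rewrite (row_ext_sum u (fun f => \sum_(d in darts f | dedge d == dedge (x, y)) 1)%R).
  move=> sum0; apply/eqP; rewrite -subr_eq0 -[(- _)%R]/(w (side H y x)).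
  rewrite -[(_ + _)%R](sum_dedge (fun d => w (side H d.1 d.2)) xy).
  apply/eqP; rewrite -[RHS]sum0.
  (* The darts over the edge are sorted by their face; the outer face adds nothing because [w]
     vanishes there. *)
  rewrite (partition_big (fun d => side H d.1 d.2) predT) //= (bigD1 (outer H)) //=.
  rewrite big1 ?add0r; last first.
    by move=> d /andP[_ /eqP ->]; rewrite /w row_ext_out // !inE eqxx.
  apply: eq_big => [f|f _]; first by rewrite !inE.
  rewrite mulr_sumr; apply: eq_big => [d|d]; last first.
    by move=> /andP[_ /eqP ->]; rewrite mulr1.
  by rewrite inE -!andbA; do 2!bool_congr; rewrite andbC.
have w_const x f g : incident H (@side _ H) (@around _ H) x f ->
    incident H (@side _ H) (@around _ H) x g -> w f = w g.
  rewrite /incident => /andP[_]; case: ifP => [_|_ /eqP <- /andP[_ /eqP <-] //].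
  move=> /existsP[y /andP[xy /eqP <-]] /andP[_ /existsP[z /andP[xz /eqP <-]]].
  have : z \in porbit (Defs.rot H x) y by rewrite (rot_cyclic xy) inE.
  case/porbitP=> k ->; elim: k {z xz} => [|k IH]; first by rewrite perm1.
  set z := ((Defs.rot H x ^+ k)%g y) in IH *.
  have xz : adj H x z.
    by have := mem_porbit (Defs.rot H x) k y; rewrite (rot_cyclic xy) inE.
  (* One turn around [x] crosses one edge: the dart after [(x, z)] has the face of [(z, x)]. *)
  rewrite expgSr permM -/z IH (w_side _ _ xz).
  have zx : adj H z x by rewrite adj_sym.
  by rewrite -(side_next zx) w_side // rot_adj.
have w0 f : w f = false.
  have : w (outer H) = false by rewrite /w row_ext_out // !inE eqxx.
  have /connectP[p] := face_linked (outer H) f.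
  elim: p (outer H) => [|g p IH] h /=; first by move=> _ ->.
  case/andP=> /existsP[x /andP[xh xg]] pp e wh; apply: IH pp e _.
  by rewrite -(w_const _ _ _ xh xg).
by apply/rowP=> i; rewrite mxE -row_ext_enum; apply: w0.
Qed.

Lemma sum_incident (g : T -> bool) x y : adj H x y ->
  (\sum_(z in vset H) g z * (z \in dedge (x, y)))%R = g x (+) g y.
Proof.
move=> xy; have yx : adj H y x by rewrite adj_sym.
have nyx : y != x by apply: contraTneq xy => ->; rewrite adj_irr.
rewrite (bigD1 x) ?(adj_vset xy) //= (bigD1 y) ?(adj_vset yx) //= set21 set22.
rewrite !mulr1 big1 ?addr0 // => z /andP[/andP[_ zx] zy].
by rewrite !inE (negPf zx) (negPf zy) mulr0.
Qed.

Lemma row_vertex_edge (u : 'rV_#|vset H|) x y (xy : adj H x y)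
    (eE : dedge (x, y) \in edges H) :
  (u *m vertex_edge)%R 0%R (enum_rank_in eE (dedge (x, y)))
  = row_ext u x (+) row_ext u y.
Proof.
rewrite mxE -(sum_incident _ xy) -row_ext_sum; apply: eq_bigr => i _.
by rewrite mxE enum_rankK_in.
Qed.

(** A function in the kernel has equal values at adjacent vertices, so one value per component
    determines it; [S] reads off the values at the roots and is injective on the kernel. *)
Lemma vertex_edge_kermx_rank :
  \rank (kermx vertex_edge) <= n_comp (adj H) (vset H).
Proof.
pose Ro := [set x in vset H | roots (adj H) x].
have -> : n_comp (adj H) (vset H) = #|Ro|.
  by apply: eq_card => x; rewrite !inE andbC.
pose S : 'M[bool]_(#|vset H|, #|Ro|) :=
  (\matrix_(i, r) ((enum_val r : T) == enum_val i))%R.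
rewrite -(mxrank_mul_ker _ S) [X in _ + X](_ : _ = 0) ?addn0 ?rank_leq_col //.
apply/eqP; rewrite mxrank_eq0; apply/rowV0P => u.
rewrite sub_capmx => /andP[/sub_kermxP uM /sub_kermxP uS].
pose g := row_ext u.
have g_adj x y : adj H x y -> g x = g y.
  move=> xy; have eE := dedge_edges (d := (x, y)) xy.
  have := row_vertex_edge u xy eE; rewrite uM mxE.
  by rewrite -/g; case: (g x); case: (g y).
have g_connect x y : connect (adj H) x y -> g x = g y.
  case/connectP=> p; elim: p x => [|z p IH] x /=; first by move=> _ ->.
  by case/andP=> /g_adj -> zp e; apply: IH.
have g_root r : r \in Ro -> g r = false.
  move=> rR; have := congr1 (fun M : 'rV_ _ => M 0%R (enum_rank_in rR r)) uS.
  rewrite !mxE; under eq_bigr do rewrite !mxE enum_rankK_in //.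
  rewrite (row_ext_sum u (fun z => r == z)) (bigD1 r) /=; last first.
    by move: rR; rewrite inE => /andP[].
  rewrite eqxx mulr1 big1 ?addr0 // => z /andP[_].
  by rewrite eq_sym => /negPf ->; rewrite mulr0.
apply/rowP=> i; rewrite mxE -row_ext_enum -/g.
have symH : connect_sym (adj H) by apply: sym_connect_sym; apply: adj_sym.
rewrite (g_connect _ _ (connect_root (adj H) (enum_val i))) g_root //.
rewrite inE roots_root // andbT.
have /connectP[p] := connect_root (adj H) (enum_val i).
case/lastP: p => [_ ->|p z]; first exact: enum_valP.
rewrite rcons_path last_rcons => /andP[_ lz] ->.
by apply: (@adj_vset _ _ _ (last (enum_val i) p)); rewrite adj_sym.
Qed.

(* Euler's formula makes the space of cocycles no larger than that of
   coboundaries. *)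
Lemma near_triangulation_cocycle (phi : T -> T -> bool) :
  near_triangulation H -> symmetric phi ->
  (forall x y z, adj H x y -> adj H y z -> adj H z x ->
     phi x y (+) phi y z (+) phi z x = false) ->
  exists g : T -> bool, forall x y, adj H x y -> phi x y = g x (+) g y.
Proof.
move=> triH symphi cocycle.
(* Every inner face is a triangle of the graph, so an edge function summing to zero over all
   triangles is in the kernel. *)
have kerP (psi : {set T} -> bool) (u : 'rV_#|edges H|) :
    (forall e, u 0%R e = psi (enum_val e)) ->
    (forall x y z, adj H x y -> adj H y z -> adj H z x ->
     psi (dedge (x, y)) (+) psi (dedge (y, z)) (+) psi (dedge (z, x)) = false) ->
    (u <= kermx edge_face)%MS.
  move=> uE psiC; apply/sub_kermxP/rowP=> f; rewrite (edge_face_row _ uE) mxE.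
  have := enum_valP f; rewrite !inE => /triH/darts_triangle[x [y [z [xy yz zx ->]]]].
  have n1 : x != y by apply: contraTneq xy => ->; rewrite adj_irr.
  have n2 : y != z by apply: contraTneq yz => ->; rewrite adj_irr.
  have n3 : z != x by apply: contraTneq zx => ->; rewrite adj_irr.
  rewrite setUC big_setU1 ?big_setU1 ?big_set1 /=; last 2 first.
  - by rewrite inE xpair_eqE negb_and n1.
  - by rewrite !inE !xpair_eqE negb_or !negb_and n3 [z == y]eq_sym n2.
  rewrite -[RHS](psiC _ _ _ xy yz zx) addrC //.
(* A vertex of a triangle lies on exactly two of its edges, so coboundaries are cocycles. *)
have sub_ker : (vertex_edge <= kermx edge_face)%MS.
  apply/row_subP => i; apply: (kerP (fun e => enum_val i \in e)) => [e|].
    by rewrite !mxE.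
  move=> x y z xy yz zx; rewrite !inE /=.
  have nadj a b : adj H a b -> (a == b) = false.
    by apply: contraTF => /eqP ->; rewrite adj_irr.
  case: (eqVneq (enum_val i) x) => [->|_].
    by rewrite (nadj _ _ xy) eq_sym (nadj _ _ zx).
  case: (eqVneq (enum_val i) y) => [->|_]; first by rewrite (nadj _ _ yz).
  by case: (_ == z).
have F_gt0 : 0 < #|face H| by apply/card_gt0P; exists (outer H).
(* With c components, the kernel has dimension E - (F - 1) and the image at least V - c; Euler's
   formula identifies these numbers. *)
have /eqP : \rank vertex_edge = \rank (kermx edge_face).
  apply/eqP; rewrite eqn_leq mxrankS //= mxrank_ker edge_face_rank.
  have count (r c v e f : nat) :
    0 < f -> v + f = e + c + 1 -> v - r <= c -> e - f.-1 <= r by lia.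
  by apply: (count _ _ _ _ _ F_gt0 (euler H)); rewrite -mxrank_ker vertex_edge_kermx_rank.
rewrite (mxrank_leqif_sup sub_ker) => ker_sub.
(* By symmetry [phi] descends to a function of undirected edges, hence to a row vector. *)
pose psi (e : {set T}) := [exists d : T * T, (dedge d == e) && phi d.1 d.2].
have psiE x y : psi (dedge (x, y)) = phi x y.
  apply/existsP/idP => [[[a b] /andP[/eqP/dedge_inj_or[] [-> ->]]] //|xy].
    by rewrite symphi.
  by exists (x, y); rewrite eqxx.
pose u : 'rV[bool]_#|edges H| := (\row_e psi (enum_val e))%R.
have /submxP[D uD] : (u <= vertex_edge)%MS.
  apply: submx_trans ker_sub; apply: (kerP psi) => [e|x y z]; first by rewrite mxE.
  by rewrite !psiE; apply: cocycle.
exists (row_ext D) => x y xy; have eE := dedge_edges (d := (x, y)) xy.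
by rewrite -(row_vertex_edge D xy eE) -uD mxE enum_rankK_in // psiE.
Qed.
End Cohomology.

(** * Zones of a tree decomposition *)

Section Branches.
Variables (N : finType) (t : graph N).

Definition avoiding (s u v : N) := [&& adj t u v, u != s & v != s].

(** For a neighbour [a] of [s], this is the component of [t] minus [s] that contains [a]. *)
Definition branch s a : {set N} := [set i | connect (avoiding s) a i].

Lemma avoiding_sym s : connect_sym (avoiding s).
Proof.
by apply: sym_connect_sym => u v; rewrite /avoiding adj_sym [(u != s) && _]andbC.
Qed.

Lemma adj_neq u v : adj t u v -> u != v.
Proof. by apply: contraTneq => ->; rewrite adj_irr. Qed.

Lemma branch_refl s a : a \in branch s a.
Proof. by rewrite inE. Qed.

Lemma branchW s a i : adj t s a -> i \in branch s a -> (i \in vset t) && (i != s).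
Proof.
move=> sa; rewrite inE => /connectP[p]; case/lastP: p => [_ ->|p z] /=.
  by rewrite (@adj_vset _ _ _ s) 1?adj_sym // eq_sym adj_neq.
rewrite rcons_path last_rcons /= => /and3P[_ lz /andP[_ zs]] ->.
by rewrite (@adj_vset _ _ _ (last a p)) 1?adj_sym.
Qed.

(** A path without repetitions never returns to [s] after its first step. Later [r] is the whole
    tree, the tree with a node avoided, or the subtree of the bags holding a given vertex. *)
Lemma branch_step (r : rel N) s i : subrel r (adj t) -> connect r s i -> i != s ->
  exists2 a, r s a & i \in branch s a.
Proof.
move=> rt /connectP[p0 p0P ->]; case/shortenP: p0P => -[|a p] /=; first by rewrite eqxx.
case/andP=> ra pP /and3P[sap _ _] _ _; exists a => //.
rewrite inE; apply/connectP; exists p => //.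
elim: p a sap pP {ra} => //= b p IH a; rewrite !inE !negb_or.
case/and3P=> sa sb sp /andP[rab pP]; rewrite /avoiding rt // ![_ == s]eq_sym sa sb /=.
by apply: IH => //; rewrite inE negb_or sb.
Qed.

Lemma branch_connect s a i j : i \in branch s a ->
  connect (avoiding s) i j -> j \in branch s a.
Proof. by rewrite !inE; apply: connect_trans. Qed.

Hypothesis tree_t : tree t.

(** Otherwise a simple path from [a] to [b] that misses [s] closes up through [s] to a cycle of
    length at least three. *)
Lemma branch_disjoint s a b i : adj t s a -> adj t s b ->
  i \in branch s a -> i \in branch s b -> a = b.
Proof.
move=> sa sb; rewrite !inE => ai bi.
have /connectP[p0 p0P e] : connect (avoiding s) a b.
  by apply: connect_trans ai _; rewrite avoiding_sym.
apply: contraTeq isT => nab; case/shortenP: p0P e => p pP up _ e.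
have pt : path (adj t) a p by apply: sub_path pP => u v /andP[].
have sp : s \notin a :: p.
  rewrite inE negb_or adj_neq //=; elim: p a {sa ai nab up e pt} pP => //= c p IH a.
  by case/andP=> /and3P[_ _ cs] /IH; rewrite inE negb_or eq_sym cs.
have cyc : ucycle (adj t) (s :: a :: p).
  by apply/andP; split; rewrite /= ?sp ?up // rcons_path sa pt -e adj_sym sb.
have := tree_t.2 _ cyc; case: p e {pP up pt sp cyc} => // /eqP.
by rewrite eq_sym (negPf nab).
Qed.

(** [s] lies in the branch at [a] towards [s], hence not in the one towards [b]; so paths inside the
    latter also avoid [s]. *)
Lemma branch_sub s a b : adj t s a -> adj t a b -> b != s ->
  s \notin branch a b /\ branch a b \subset branch s a.
Proof.
move=> sa ab bs; have as_ : adj t a s by rewrite adj_sym.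
have sNb : s \notin branch a b.
  by apply: contraNN bs => /(branch_disjoint ab as_)->; rewrite ?branch_refl.
split=> //; apply/subsetP=> i; rewrite !inE => /connectP[p pP ->].
apply: (connect_trans (y := b)).
  by apply: connect1; rewrite /avoiding ab bs eq_sym adj_neq.
elim/last_ind: p pP => [|p z IH]; first by rewrite connect0.
rewrite rcons_path last_rcons => /andP[pP lz]; apply: connect_trans (IH pP) _.
have lb : last b p \in branch a b by rewrite inE; apply/connectP; exists p.
have zb : z \in branch a b by apply: branch_connect lb _; apply: connect1.
apply: connect1; rewrite /avoiding; case/and3P: lz => -> _ _ /=.
by apply/andP; split; [move: lb|move: zb]; apply: contraTneq => ->.
Qed.

(** A simple path from [s] to [i] avoiding [a] would leave [s] by another neighbour, and [i] would
    lie in two branches at [s]. *)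
Lemma branch_opposite s a i : adj t s a ->
  i \in branch s a -> i \in branch a s -> False.
Proof.
move=> sa ia ias; have /andP[_ si] := branchW sa ia.
have /andP[_ ai] : (i \in vset t) && (i != a) by apply: branchW ias; rewrite adj_sym.
move: ias; rewrite inE => ias.
have [|c] := @branch_step (avoiding a) s i _ ias si; first by move=> u v /andP[].
case/and3P=> sc _ ca ic; have := branch_disjoint sa sc ia ic.
by move=> e; rewrite e eqxx in ca.
Qed.

End Branches.

(** * Parts of the decomposed graph beyond a tree edge *)

Section Zones.
Variables (T N : finType) (H : graph T) (t : graph N) (bag : N -> {set T}).
Hypothesis Hbag : tree_decomposition H t bag.

Let tree_t : tree t. Proof. by case: Hbag. Qed.

(* The part of [H] that the decomposition places strictly beyond the tree edge
   from [s] to [a]. *)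
Definition zone s a : {set T} :=
  [set x in vset H | (x \notin bag s) && [exists i in branch t s a, x \in bag i]].

Lemma zoneP s a x :
  reflect [/\ x \in vset H, x \notin bag s & exists2 i, i \in branch t s a & x \in bag i]
    (x \in zone s a).
Proof.
rewrite inE; apply: (iffP and3P) => [[? ? /exists_inP]|[? ? ?]]; split=> //.
exact/exists_inP.
Qed.

Lemma bag_connect x i j : x \in vset H -> i \in vset t -> j \in vset t ->
  x \in bag i -> x \in bag j -> connect (adj (induced t [set i | x \in bag i])) i j.
Proof.
case: Hbag => _ _ _ sub xH it jt xi xj; have [_] := sub x xH.
by apply; rewrite !inE ?it ?jt ?xi ?xj.
Qed.

(** The nodes whose bags contain [x] are connected and do not include [s], so they all lie in one
    branch at [s]. *)
Lemma zone_branch s a x i : adj t s a -> x \in zone s a ->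
  i \in vset t -> x \in bag i -> i \in branch t s a.
Proof.
move=> sa /zoneP[xH xs [j jb xj]] it xi; have /andP[jt _] := branchW sa jb.
apply: branch_connect jb _; have := bag_connect xH jt it xj xi.
apply: connect_sub => u v /and3P[uv]; rewrite !inE => xu xv.
apply: connect1; rewrite /avoiding uv /=.
by apply/andP; split; [move: xu|move: xv]; apply: contraTneq => ->.
Qed.

Lemma zone_cover s x : s \in vset t -> x \in vset H -> x \notin bag s ->
  exists2 a, adj t s a & x \in zone s a.
Proof.
move=> st xH xs; have [i /setIP[it]] : exists i, i \in vset t :&: [set i | x \in bag i].
  by apply/set0Pn; case: Hbag => _ _ _ /(_ x xH) [].
rewrite inE => xi; have si : i != s by apply: contraTneq xi => ->.
have conn : connect (adj t) s i by apply: tree_t.1.2.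
have [a sa ib] := branch_step (fun _ _ => id) conn si.
by exists a => //; apply/zoneP; split=> //; exists i.
Qed.

Lemma zone_disjoint s a b x : adj t s a -> adj t s b ->
  x \in zone s a -> x \in zone s b -> a = b.
Proof.
move=> sa sb xa xb; have /zoneP[_ _ [i ib xi]] := xb.
have /andP[it _] := branchW sb ib.
exact: branch_disjoint sa sb (zone_branch sa xa it xi) ib.
Qed.

Lemma zone_opposite s a x : adj t s a -> x \in zone s a -> x \in zone a s -> False.
Proof.
move=> sa xa xs; have as_ : adj t a s by rewrite adj_sym.
have /zoneP[_ _ [i ib xi]] := xs; have /andP[it _] := branchW as_ ib.
exact: branch_opposite sa (zone_branch sa xa it xi) ib.
Qed.

Lemma zone_sub s a b : adj t s a -> adj t a b -> b != s ->
  zone a b \subset zone s a.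
Proof.
move=> sa ab bs; have [sNb bsub] := branch_sub tree_t sa ab bs.
apply/subsetP=> x xb; have /zoneP[xH xa [i ib xi]] := xb.
apply/zoneP; split=> //; last by exists i => //; apply: (subsetP bsub).
apply: contraNN sNb; apply: zone_branch ab xb _; exact: adj_vset sa.
Qed.

(** Some bag beyond the tree edge holds both [x] and [y]. If [y] is also in [bag s], its subtree
    passes from [s] into that branch through [a], so [y] is in both bags. *)
Lemma zone_closed s a x y : adj t s a -> adj H x y -> x \in zone s a ->
  y \notin bag s :&: bag a -> y \in zone s a.
Proof.
move=> sa xy xz yB; have yH : y \in vset H by rewrite (@adj_vset _ _ _ x) 1?adj_sym.
have [i it /andP[xi yi]] : exists2 i, i \in vset t & (x \in bag i) && (y \in bag i).
  by case: Hbag => _ _ + _; apply.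
have ib := zone_branch sa xz it xi.
have /andP[_ si] := branchW sa ib.
apply/zoneP; split=> //; last by exists i.
apply: contraNN yB => ys; rewrite inE ys /=.
have st := adj_vset sa; have conn := bag_connect yH st it ys yi.
have rt : subrel (adj (induced t [set i | y \in bag i])) (adj t).
  by move=> u v /andP[].
have [c] := branch_step rt conn si.
case/and3P=> sc _ + ic; rewrite inE => yc.
by rewrite (branch_disjoint tree_t sa sc ib ic).
Qed.

(* Starting from any node and always moving into a zone with [f s = true], one
   never turns back, so the branches ahead shrink forever. *)
Lemma no_odd_zones (f : N -> {set T} -> bool) :
  (forall s (W1 W2 : {set T}), [disjoint W1 & W2] -> f s (W1 :|: W2) = f s W1 (+) f s W2) ->
  {in vset t, forall s W, f s W = f s (W :\: bag s)} ->
  {in vset t, forall s, f s (vset H)} ->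
  (forall s a, adj t s a -> f s (zone s a) = f a (zone s a)) -> False.
Proof.
move=> fU fbag ftot fadj.
have f0 s : f s set0 = false.
  by have := fU s set0 set0; rewrite disjoints_subset sub0set setU0 addbb; apply.
(* The zones at [s] partition the vertices outside [bag s], so by additivity an odd [W] there has an
   odd part in one of them. *)
have step s (W : {set T}) : s \in vset t -> W \subset vset H -> W :&: bag s = set0 -> f s W ->
    exists2 a, adj t s a & f s (W :&: zone s a).
  move=> st WH Ws fW; apply/(exists_inP (D := adj t s)); apply: contraTT fW => noa.
  have none r : uniq r -> all (adj t s) r ->
      f s (W :&: \bigcup_(a <- r) zone s a) = false.
    elim: r => [|a r IH] /=; first by rewrite big_nil setI0 f0.
    case/andP=> ar ur /andP[sa sr]; rewrite big_cons setIUr fU; last first.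
      rewrite disjoints_subset; apply/subsetP=> x /setIP[xW xa]; rewrite !inE xW /=.
      apply/negP; rewrite big_tnth => /bigcupP[i _ xi].
      have si : adj t s (tnth (in_tuple r) i) by apply: (allP sr); apply: mem_tnth.
      by have /negP := ar; apply; rewrite (zone_disjoint sa si xa xi) mem_tnth.
    rewrite IH // addbF; apply: contraNF noa => fa.
    by apply/exists_inP; exists a.
  have eW : W :&: \bigcup_(a <- enum (adj t s)) zone s a = W.
    apply/setIidPl/subsetP=> x xW.
    have xs : x \notin bag s by apply/negP=> xs; have := in_set0 x; rewrite -Ws inE xW xs.
    have [a sa xa] := zone_cover st (subsetP WH x xW) xs.
    by rewrite big_enum /=; apply/bigcupP; exists a.
  rewrite -eW none ?enum_uniq //.
  by apply/allP=> a; rewrite mem_enum.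
have [s st] : exists s, s \in vset t by apply/set0Pn; apply: tree_t.1.1.
have sub_zone u v : zone u v \subset vset H by apply/subsetP=> x /zoneP[].
have [||a sa] := step s (vset H :\: bag s) st (subsetDl _ _).
- by apply/setP=> x; rewrite !inE; case: (x \in bag s); rewrite ?andbF.
- by rewrite -fbag // ftot.
have -> : (vset H :\: bag s) :&: zone s a = zone s a.
  by apply/setIidPr/subsetP=> x /zoneP[xH xs _]; rewrite inE xs.
move=> fsa; have [n] := ubnP #|branch t s a|.
elim: n s a sa fsa {st} => // n IH s a sa fsa; rewrite ltnS => le_n.
have at_ : a \in vset t by rewrite (@adj_vset _ _ _ s) 1?adj_sym.
have [|||b ab] := step a (zone s a :\: bag a) at_.
- exact: subset_trans (subsetDl _ _) (sub_zone s a).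
- by apply/setP=> x; rewrite !inE; case: (x \in bag a); rewrite ?andbF.
- by rewrite -fbag // -fadj.
(* No turning back: [zone s a] and [zone a s] are disjoint, and the empty set is even. *)
have [->|bs] := eqVneq b s.
  rewrite [_ :&: _](_ : _ = set0) ?f0 //; apply/setP=> x; rewrite [RHS]inE.
  by apply/negP=> /setIP[/setDP[xa _]]; apply: zone_opposite.
have -> : (zone s a :\: bag a) :&: zone a b = zone a b.
  apply/setIidPr/subsetP=> x xb; rewrite inE (subsetP (zone_sub sa ab bs)) // andbT.
  by case/zoneP: xb.
move=> fab; apply: (IH a b ab fab); apply: leq_trans le_n; apply: proper_card.
have [_ bsub] := branch_sub tree_t sa ab bs; rewrite properE bsub /=.
(* [a] lies in the old branch but not in the new one, so the size drops strictly. *)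
apply/subsetPn; exists a; first exact: branch_refl.
by apply/negP=> /(branchW ab); rewrite eqxx andbF.
Qed.

End Zones.

(** * Crossings *)

Section Crossings.
Variable T : finType.
Implicit Types (A W X : {set T}) (H S : graph T) (p : seq T).

Fixpoint path_sum (phi : T -> T -> bool) x p :=
  if p is y :: q then phi x y (+) path_sum phi y q else false.

Lemma path_sum_coboundary (e : rel T) (phi : T -> T -> bool) (g : T -> bool) x p :
  (forall u v, e u v -> phi u v = g u (+) g v) -> path e x p ->
  path_sum phi x p = g x (+) g (last x p).
Proof.
move=> phiE; elim: p x => [|y p IH] x /=; first by rewrite addbb.
by case/andP=> xy yp; rewrite IH // phiE // -addbA addKb.
Qed.

Lemma eq_path_sum (e : rel T) phi psi x p :
  (forall u v, e u v -> phi u v = psi u v) -> path e x p ->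
  path_sum phi x p = path_sum psi x p.
Proof.
by move=> E; elim: p x => //= y p IH x /andP[xy yp]; rewrite E // IH.
Qed.

Lemma path_sumD phi psi x p :
  path_sum (fun u v => phi u v (+) psi u v) x p
  = path_sum phi x p (+) path_sum psi x p.
Proof. by elim: p x => //= y p IH x; rewrite IH addbACA. Qed.

(** The indicator of the edges between [W] and [A] when these are disjoint, since then the two terms
    are never both true. *)
Definition crossing A W (u v : T) :=
  ((u \in W) && (v \in A)) (+) ((u \in A) && (v \in W)).

Lemma crossing_sym A W : symmetric (crossing A W).
Proof. by move=> u v; rewrite /crossing addbC ![(u \in _) && _]andbC. Qed.

Lemma crossingU A W1 W2 u v : [disjoint W1 & W2] ->
  crossing A (W1 :|: W2) u v = crossing A W1 u v (+) crossing A W2 u v.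
Proof.
rewrite disjoint_subset => /subsetP d12; rewrite /crossing !inE.
have du := d12 u; have dv := d12 v; rewrite !inE in du dv; move: du dv.
case: (u \in W1); case: (v \in W1); case: (u \in W2); case: (v \in W2);
  do ?[by move/(_ isT)]; do ?[by move=> _ /(_ isT)];
  by case: (u \in A); case: (v \in A).
Qed.

(* [A] plays the role of the side of [S1] in the complement of [X]. *)
Lemma path_sum_crossing_const (H : plane_graph T) S1 S2 A W X x p x' p' :
  near_triangulation H ->
  W \subset X -> [disjoint A & X] ->
  [disjoint vset S1 & X] -> [disjoint vset S2 & X] ->
  (forall u v, adj H u v -> u \in A -> v \in A :|: X) ->
  (forall u v, adj H u v -> u \in W -> v \in X -> v \in W) ->
  connected (gcap H S1) -> connected (gcap H S2) ->
  path (adj H) x p -> x \in vset (gcap H S1) -> last x p \in vset (gcap H S2) ->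
  path (adj H) x' p' -> x' \in vset (gcap H S1) -> last x' p' \in vset (gcap H S2) ->
  path_sum (crossing A W) x p = path_sum (crossing A W) x' p'.
Proof.
move=> triH /subsetP WX; rewrite 3!disjoint_subset.
move=> /subsetP AX /subsetP S1X /subsetP S2X Aadj Wadj conn1 conn2.
(* If an edge of the triangle joins [W] to [A], its third vertex is in [A] or [X] because of the
   neighbour in [A], and in the latter case in [W] because of the neighbour in [W]; so exactly two
   edges cross. *)
have cocycle u v w : adj H u v -> adj H v w -> adj H w u ->
    crossing A W u v (+) crossing A W v w (+) crossing A W w u = false.
  move=> uv vw wu; have vu : adj H v u by rewrite adj_sym.
  have wv : adj H w v by rewrite adj_sym.
  have uw : adj H u w by rewrite adj_sym.
  have WXb a : (a \in W) ==> (a \in X) by apply/implyP/WX.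
  have AXb a : (a \in A) ==> (a \notin X) by apply/implyP/AX.
  have Ab a b : adj H a b -> (a \in A) ==> (b \in A) || (b \in X).
    by move=> /Aadj ab; apply/implyP => /ab; rewrite inE.
  have Wb a b : adj H a b -> (a \in W) ==> (b \in X) ==> (b \in W).
    by move=> /Wadj ab; apply/implyP => /ab ?; apply/implyP.
  move: (WXb u) (WXb v) (WXb w) (AXb u) (AXb v) (AXb w).
  move: (Ab _ _ uv) (Ab _ _ vu) (Ab _ _ vw) (Ab _ _ wv) (Ab _ _ uw) (Ab _ _ wu).
  move: (Wb _ _ uv) (Wb _ _ vu) (Wb _ _ vw) (Wb _ _ wv) (Wb _ _ uw) (Wb _ _ wu).
  rewrite /crossing.
  by case: (u \in X); case: (u \in A); case: (u \in W) => //=;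
    case: (v \in X); case: (v \in A); case: (v \in W) => //=;
    case: (w \in X); case: (w \in A); case: (w \in W).
have [g gE] := near_triangulation_cocycle triH (crossing_sym A W) cocycle.
(* Each side misses [X], hence [W], so no edge inside it crosses, and the potential [g] is constant
   on its connected intersection with [H]. *)
have g_const S : {subset vset S <= [predC X]} -> connected (gcap H S) ->
    {in vset (gcap H S) &, forall u v, g u = g v}.
  move=> SX [_ conn] u v uS vS; have /connectP[q] := conn u v uS vS.
  elim: q u {uS} => [|w q IH] u /=; first by move=> _ ->.
  case/andP=> /andP[uw Suw] qP e; rewrite -(IH w qP e).
  have := gE _ _ uw; rewrite /crossing.
  have uS : u \in vset S := adj_vset Suw.
  have wS : w \in vset S by rewrite (@adj_vset _ _ _ u) 1?adj_sym.
  rewrite (contraNF (WX u)) ?(contraNF (WX w)) ?andbF //=; last 2 first.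
  - by have := SX w wS; rewrite !inE.
  - by have := SX u uS; rewrite !inE.
  by case: (g u); case: (g w).
move=> pP x1 p2 pP' x1' p2'.
rewrite (path_sum_coboundary gE pP) (path_sum_coboundary gE pP').
by rewrite (g_const S1 S1X conn1 x x' x1 x1') (g_const S2 S2X conn2 _ _ p2 p2').
Qed.

Lemma is_path_path H x p : is_path H x p -> path (adj H) x p.
Proof.
case=> _ _ adjE; have: forall u v, (u, v) \in zip (x :: p) p -> adj H u v.
  by move=> u v uv; rewrite adjE uv.
elim: p x {adjE} => //= y p IH x adjH; rewrite adjH ?inE ?eqxx //=.
by apply: IH => u v uv; apply: adjH; rewrite inE uv orbT.
Qed.

Lemma is_path_connected H x p : is_path H x p -> connected H.
Proof.
move=> P; have pP := is_path_path P; case: P => _ vE _.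
have xc u : u \in vset H -> connect (adj H) x u.
  by rewrite vE inE => ?; apply: (path_connect pP).
split; first by apply/set0Pn; exists x; rewrite vE inE mem_head.
move=> u v uH vH; apply: connect_trans (xc v vH).
by rewrite sym_connect_sym ?xc //; apply: adj_sym.
Qed.

(** Otherwise choosing a point of [B] in each [V i] injects ['I_n] into [B]. *)
Lemma disjoint_family_avoid n (V : 'I_n -> {set T}) (B : {set T}) :
  (forall i j, i != j -> [disjoint V i & V j]) -> #|B| < n ->
  exists i, [disjoint V i & B].
Proof.
move=> dV Bn; apply/existsP; apply: contraTT Bn => /existsPn meet.
have f i : {x | (x \in V i) && (x \in B)}.
  apply: sigW; have := meet i; rewrite -setI_eq0 => /set0Pn[x /setIP[xV xB]].
  by exists x; rewrite xV.
rewrite -leqNgt -[X in X <= _]card_ord -(card_imset _ (f := fun i => sval (f i))).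
  apply/subset_leq_card/subsetP=> _ /imsetP[i _ ->].
  by case: (f i) => x /= /andP[].
move=> i j e; apply/eqP; apply: contraT => nij.
have := dV i j nij; rewrite -setI_eq0 => /eqP/setP/(_ (sval (f i))).
rewrite in_set0 inE {2}e; case: (f i) => x /= /andP[-> _].
by case: (f j) => y /= /andP[-> _].
Qed.

End Crossings.

(** * Parities of row-column paths in a slab *)

Lemma slab_max_bag (T : finType) (n k : nat) (G S1 S2 : graph T)
    (rows cols : 'I_n -> plane_graph T) (X : {set T}) :
  0 < n -> slab G S1 S2 rows cols ->
  X \subset vset G :\: (vset S1 :|: vset S2) -> separates G S1 S2 X ->
  has_max_bag (induced G X) k -> n <= k.
Proof.
move=> n_gt0 slabG XG sepX [N [t [bag [Hbag bagk]]]]; rewrite leqNgt; apply/negP=> kn.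
case: slabG => [[S1G S2G _ _ _] [rowP colP] dR dC meet].
have XS S : S = S1 \/ S = S2 -> [disjoint vset S & X].
  move=> SS; rewrite disjoint_sym disjoint_subset; apply/subsetP=> x /(subsetP XG).
  rewrite !inE negb_or => /andP[/andP[x1 x2] _].
  by case: SS => ->.
have X1 := XS S1 (or_introl erefl); have X2 := XS S2 (or_intror erefl).
have vX : vset (induced G X) = X.
  by apply/setIidPr/subsetP=> x /(subsetP XG) /setDP[].
(* Only the head of an edge is required to avoid [X]; walks start in [S1], which is disjoint from
   [X]. *)
pose e : rel T := [rel u v | adj G u v && (v \notin X)].
pose A := [set v | [exists u in vset S1, connect e u v]].
have S1A x : x \in vset S1 -> x \in A.
  by move=> x1; rewrite inE; apply/exists_inP; exists x.
have AX : [disjoint A & X].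
  rewrite disjoint_subset; apply/subsetP=> v; rewrite !inE => /exists_inP[u u1].
  case/connectP=> p; case/lastP: p => [_ ->|p z].
    by move: u1; apply: contraTN => uX; rewrite (disjointFl X1 uX).
  by rewrite rcons_path last_rcons /= => /and3P[_ _ zX] ->.
have Aadj u v : adj G u v -> u \in A -> v \in A :|: X.
  move=> uv; rewrite !inE => /exists_inP[w w1 wu].
  case: (boolP (v \in X)) => vX'; rewrite ?orbT // orbF.
  apply/exists_inP; exists w => //; apply: connect_trans wu _.
  by apply: connect1; rewrite /e /= uv.
have S2A x : x \in vset S2 -> x \notin A.
  move=> x2; apply/negP; rewrite inE => /exists_inP[u u1 /connectP[p0 p0P ex]].
  move: x2; rewrite ex; case/shortenP: p0P => p pP up _ p2.
  have pG : path (adj G) u p by apply: sub_path pP => a b /andP[].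
  have := sepX u p pG up u1 p2; rewrite /= (disjointFr X1 u1) /=.
  elim: p u {u1 up pG p2 ex} pP => //= y p IH u /andP[/andP[_ yX] yp].
  by rewrite (negPf yX); apply: IH yp.
clearbody A.
have small s : s \in vset t -> #|bag s| < n.
  move=> st; apply: leq_ltn_trans kn; rewrite -bagk.
  exact: (leq_bigmax_cond (F := fun i => #|bag i|)).
(* At nodes outside the tree, index 0 is a dummy value. *)
have /choice[ri riP] s : exists i, s \in vset t -> [disjoint vset (rows i) & bag s].
  case: (boolP (s \in vset t)) => [/small/(disjoint_family_avoid dR)[i di]|_].
    by exists i.
  by exists (Ordinal n_gt0).
have /choice[ci ciP] s : exists j, s \in vset t -> [disjoint vset (cols j) & bag s].
  case: (boolP (s \in vset t)) => [/small/(disjoint_family_avoid dC)[i di]|_].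
    by exists i.
  by exists (Ordinal n_gt0).
have /choice[q qP] ij : exists q : T * seq T,
    [/\ is_path (gcap (rows ij.1) (cols ij.2)) q.1 q.2,
        q.1 \in vset S1 & last q.1 q.2 \in vset S2].
  by have [x [p P]] := meet ij.1 ij.2; exists (x, p).
pose par W ij := path_sum (crossing A W) (q ij).1 (q ij).2.
have qpath ij : path (adj (gcap (rows ij.1) (cols ij.2))) (q ij).1 (q ij).2.
  by case: (qP ij) => /is_path_path.
have qends ij x : x = (q ij).1 \/ x = last (q ij).1 (q ij).2 ->
    x \in vset (rows ij.1) /\ x \in vset (cols ij.2).
  move=> xq; apply/setIP; case: (qP ij) => -[_ vE _] _ _.
  rewrite -[_ :&: _]/(vset (gcap _ _)) vE inE.
  by case: xq => ->; rewrite ?mem_head ?mem_last.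
(* [H] is a row or column containing the paths of both index pairs. *)
have line_const (H : plane_graph T) (W : {set T}) ij ij' :
    [/\ subgraph H G, near_triangulation H &
        forall S, S = S1 \/ S = S2 ->
          (exists x p, is_path (gcap H S) x p) /\
          subgraph (gcap H S) (face_boundary (outer H))] ->
    W \subset X -> (forall u v, adj H u v -> u \in W -> v \in X -> v \in W) ->
    (forall ij0, ij0 = ij \/ ij0 = ij' -> H = rows ij0.1 \/ H = cols ij0.2) ->
    par W ij = par W ij'.
  case=> [[_ HG] triH HS] WX Wadj Hij.
  have conn S : S = S1 \/ S = S2 -> connected (gcap H S).
    by case/HS => -[x [p]] /is_path_connected.
  have path_ends ij0 : ij0 = ij \/ ij0 = ij' ->
      [/\ path (adj H) (q ij0).1 (q ij0).2, (q ij0).1 \in vset (gcap H S1) &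
          last (q ij0).1 (q ij0).2 \in vset (gcap H S2)].
    move=> /Hij Hij0; case: (qP ij0) => _ q1 q2.
    have Hend x : x = (q ij0).1 \/ x = last (q ij0).1 (q ij0).2 -> x \in vset H.
      by case/qends; case: Hij0 => ->.
    split; rewrite ?inE ?q1 ?q2 ?Hend //; try by auto.
    by apply: sub_path (qpath ij0) => u v /andP[]; case: Hij0 => ->.
  have [pP x1 x2] := path_ends ij (or_introl erefl).
  have [pP' x1' x2'] := path_ends ij' (or_intror erefl).
  apply: (path_sum_crossing_const triH WX AX X1 X2) => //; try by apply: conn; auto.
  by move=> u v /HG; apply: Aadj.
pose f s W := par W (ri s, ci s).
apply: (no_odd_zones Hbag (f := f)) => [s W1 W2 dW|s st W|s st|s a sa].
- rewrite /f /par -path_sumD; apply: (eq_path_sum _ (qpath _)) => u v _.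
  exact: crossingU.
- apply: (eq_path_sum _ (qpath _)) => u v /andP[uv _].
  have vu : adj (rows (ri s)) v u by rewrite adj_sym.
  rewrite /crossing !inE (disjointFr (riP s st) (adj_vset uv)).
  by rewrite (disjointFr (riP s st) (adj_vset vu)).
(* For [W = X] the crossing function is the coboundary of the indicator of [A], since an edge
   leaving [A] ends in [X]; that indicator is 1 on [S1] and 0 on [S2]. *)
- rewrite vX /f /par; case: (qP (ri s, ci s)) => _ q1 q2.
  rewrite (path_sum_coboundary (g := [in A]) _ (qpath _)); last first.
    move=> u v /andP[uv _]; have uvG : adj G u v by case: (rowP (ri s)) => -[_ /(_ _ _ uv)].
    have vuG : adj G v u by rewrite adj_sym.
    move: (Aadj _ _ uvG) (Aadj _ _ vuG); rewrite /crossing !inE.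
    move: (disjointFr AX (x := u)) (disjointFr AX (x := v)).
    by case: (u \in A); case: (v \in A); case: (u \in X); case: (v \in X);
      do ?[by []|move/(_ isT)|move=> _].
  by rewrite /= S1A // (negPf (S2A _ q2)).
have st := adj_vset sa; have at_ : a \in vset t by rewrite (@adj_vset _ _ _ s) 1?adj_sym.
have WX : zone (induced G X) t bag s a \subset X.
  by apply/subsetP=> x /zoneP[]; rewrite vX.
(* Within [X], a zone can only be left through vertices in both bags, so it is enough that [H]
   avoids one of them. *)
have Wadj H : subgraph H G -> [disjoint vset H & bag s] \/ [disjoint vset H & bag a] ->
    forall u v, adj H u v -> u \in zone (induced G X) t bag s a -> v \in X ->
    v \in zone (induced G X) t bag s a.
  case=> _ HG dH u v uv uz vX'; apply: (zone_closed Hbag sa _ uz).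
    by rewrite /= HG // vX' (subsetP WX u uz).
  have vH : v \in vset H by rewrite (@adj_vset _ _ _ u) 1?adj_sym.
  by rewrite inE; case: dH => d; rewrite (disjointFr d vH) ?andbF.
have rowG i : subgraph (rows i) G by case: (rowP i).
have colG j : subgraph (cols j) G by case: (colP j).
(* First move along the row of [s], which avoids [bag s], then along the column of [a], which avoids
   [bag a]. *)
rewrite /f; apply: (etrans (y := par (zone (induced G X) t bag s a) (ri s, ci a))).
  apply: (line_const (rows (ri s))) => //.
  - by apply: Wadj => //; left; apply: riP.
  - by move=> ij [] ->; left.
apply: (line_const (cols (ci a))) => //.
- by apply: Wadj => //; right; apply: ciP.
- by move=> ij [] ->; right.
Qed.

Local Open Scope ring_scope.

Theorem theorem4 (R : realType) (T : finType) (n Delta : nat)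
    (G S1 S2 : graph T) (rows cols : 'I_n -> plane_graph T) (X : {set T}) :
  (1 <= n)%N -> (3 <= Delta)%N ->
  slab G S1 S2 rows cols ->
  (forall i, max_degree_le (rows i) Delta) ->
  (forall j, max_degree_le (cols j) Delta) ->
  X \subset vset G :\: (vset S1 :|: vset S2) ->
  separates G S1 S2 X ->
  n%:R / Num.sqrt (3 * Delta%:R) - 1 <= (treewidth (induced G X))%:~R :> R.
Proof.
move=> n_gt0 Delta3 slabG _ _ XG sepX; rewrite /treewidth.
case: ex_minnP => k /asboolP bagk _.
have le_nk := slab_max_bag n_gt0 slabG XG sepX bagk.
(* Both sides end in [- 1], and 3 Delta >= 1 gives n / sqrt(3 Delta) <= n <= k. *)
rewrite rmorphB /= lerB // (le_trans (y := n%:R)) //; last first.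
  by rewrite -[X in _ <= X]/(k%:R) ler_nat.
have sqrt1 : 1 <= Num.sqrt (3 * Delta%:R) :> R.
  by rewrite -[X in X <= _]sqrtr1 ler_sqrt -natrM ?ler0n // ler1n; lia.
by rewrite ler_pdivrMr ?(lt_le_trans ltr01) // ler_peMr ?ler0n.
Qed.
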